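(* Let $(\bar M,\bar g)$ be a Riemannian manifold with a concurrent vector field $\zeta$, and let $M$ be a hypersurface isometrically immersed in $(\bar M,\bar g)$, with induced metric $g$, such that $(M,g,\zeta^{\top},\lambda,\mu)$ is a hyperbolic Yamabe soliton for some $\lambda,\mu\in\mathbb R$. If $M$ has parallel shape operator (i.e., $\nabla A_{\zeta^{\bot}}=0$), then $M$ is a metallic shaped hypersurface if and only if its scalar curvature is constant.
   Context: A hyperbolic Yamabe soliton $(M,g,\xi,\lambda,\mu)$ is a smooth Riemannian manifold $(M,g)$ together with a smooth vector field $\xi$ tangent to $M$ (the potential vector field) and real numbers $\lambda,\mu$ such that $\pounds_{\xi}\pounds_{\xi}g+\lambda\pounds_{\xi}g=(\mu-r)g$, where $r$ is the scalar curvature of $(M,g)$, $\pounds_{\xi}g$ is the Lie derivative of $g$, and $\pounds_{\xi}\pounds_{\xi}g:=\pounds_{\xi}(\pounds_{\xi}g)$. A vector field $\zeta$ on $(\bar M,\bar g)$ is concurrent if $\bar\nabla\zeta=I$ (i.e., $\bar\nabla_X\zeta=X$ for all $X$), where $\bar\nabla$ is the Levi-Civita connection of $\bar g$ and $I$ is the identity map. Along $M$, $\zeta=\zeta^{\top}+\zeta^{\bot}$ is the decomposition into components tangent and normal to $M$. $\nabla$ is the Levi-Civita connection of the induced metric $g$. For a normal vector field $V$, the shape operator $A_V$ is defined by the Weingarten formula $\bar\nabla_XV=-A_VX+\nabla^{\bot}_XV$ for $X$ tangent to $M$, where $\nabla^{\bot}$ is the normal connection. A hypersurface is called metallic shaped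 if its shape operator $A$ satisfies $A^2=aA+bI$ for some real numbers $a$ and $b$; here the shape operator is $A=A_{\zeta^{\bot}}$.
   Formalization: M is assumed connected; otherwise the claim fails: for λ=(μ−4)/2, μ>0, the disjoint union of a hyperplane through 0 (A=0, r=0) and a sphere centred at 0 (A=−I, r=μ) in Euclidean space has parallel A with A²=−A but non-constant r. *)

(* Defs.v *)
From HB Require Import structures.
From mathcomp Require Import all_boot all_order all_algebra.
From mathcomp Require Import all_classical all_reals all_analysis.
From mathcomp Require Import ring.
Set Implicit Arguments.
Unset Strict Implicit.
Unset Printing Implicit Defensive.
Import Order.TTheory GRing.Theory Num.Theory.
Import numFieldNormedType.Exports.
Local Open Scope classical_set_scope.
Local Open Scope ring_scope.

(* Vectors are rows: a linear map with matrix A sends v to v *m A, and a      *)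
(* bilinear form with matrix B sends (u, v) to u *m B *m v^T.                 *)
(* Objects on a manifold are given by their local representatives, functions  *)
(* on the coordinate space which are only meaningful on the image of a chart; *)
(* all conditions below are imposed on these (open) images only.              *)

Section Calculus.
Variables (R : realType) (n : nat).

Fixpoint Ck (W : normedModType R) (k : nat) (U : set 'rV[R]_n)
    (F : 'rV[R]_n -> W) : Prop :=
  if k is k'.+1 then
    (forall x, U x -> differentiable F x) /\
    (forall v : 'rV[R]_n, Ck k' U (fun x => 'D_v F x))
  else forall x, U x -> {for x, continuous F}.

Definition smooth_on (W : normedModType R) (U : set 'rV[R]_n)
    (F : 'rV[R]_n -> W) : Prop := forall k, Ck k U F.

Definition bil (B : 'M[R]_n) (u v : 'rV[R]_n) : R := (u *m B *m v^T) 0 0.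

Definition evec (i : 'I_n) : 'rV[R]_n := delta_mx 0 i.

End Calculus.

Section Manifolds.
Variable R : realType.

Record smooth_manifold (n : nat) := SmoothManifold {
  carrier :> topologicalType;
  index : Type;
  dom : index -> set carrier;
  coord : index -> carrier -> 'rV[R]_n;
  param : index -> 'rV[R]_n -> carrier;
  mfd_hausdorff : hausdorff_space carrier;
  mfd_second_countable : @second_countable carrier;
  dom_open : forall i, open (dom i);
  img_open : forall i, open (coord i @` dom i);
  coordK : forall i p, dom i p -> param i (coord i p) = p;
  coord_cts : forall i p, dom i p -> {for p, continuous (coord i)};
  param_cts : forall i x, (coord i @` dom i) x -> {for x, continuous (param i)};
  dom_cover : forall p, exists i, dom i p;
  transition_smooth : forall i j,
    smooth_on [set x | (coord i @` dom i) x /\ dom j (param i x)]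
      (fun x => coord j (param i x)) }.

Section OneManifold.
Variables (n : nat) (M : smooth_manifold n).

Definition img (i : index M) : set 'rV[R]_n := coord i @` dom i.

Definition overlap (i j : index M) : set 'rV[R]_n :=
  [set x | img i x /\ dom j (param i x)].

Definition transition (i j : index M) (x : 'rV[R]_n) : 'rV[R]_n :=
  coord j (param i x).

Record vector_field := VectorField {
  vf_rep :> index M -> 'rV[R]_n -> 'rV[R]_n;
  vf_smooth : forall i, smooth_on (img i) (vf_rep i);
  vf_change : forall i j x, overlap i j x ->
    vf_rep j (transition i j x) = 'D_(vf_rep i x) (transition i j) x }.

Record riemannian_metric := RiemannianMetric {
  metric_rep :> index M -> 'rV[R]_n -> 'M[R]_n;
  metric_smooth : forall i, smooth_on (img i) (metric_rep i);
  metric_sym : forall i x, img i x -> (metric_rep i x)^T = metric_rep i x;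
  metric_pos : forall i x (v : 'rV[R]_n), img i x -> v != 0 ->
    0 < bil (metric_rep i x) v v;
  metric_change : forall i j x (u v : 'rV[R]_n), overlap i j x ->
    bil (metric_rep i x) u v =
    bil (metric_rep j (transition i j x))
      ('D_u (transition i j) x) ('D_v (transition i j) x) }.

Record endo_field := EndoField {
  endo_rep :> index M -> 'rV[R]_n -> 'M[R]_n;
  endo_smooth : forall i, smooth_on (img i) (endo_rep i);
  endo_change : forall i j x (v : 'rV[R]_n), overlap i j x ->
    'D_(v *m endo_rep i x) (transition i j) x =
    'D_v (transition i j) x *m endo_rep j (transition i j x) }.

End OneManifold.
End Manifolds.

Section LocalGeometry.
Variables (R : realType) (n : nat).
Implicit Types (X Y Z : 'rV[R]_n -> 'rV[R]_n) (g T : 'rV[R]_n -> 'M[R]_n).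

Definition bracket X Y (x : 'rV[R]_n) : 'rV[R]_n :=
  'D_(X x) Y x - 'D_(Y x) X x.

(* (L_X T)(Y, Z) = X (T(Y, Z)) - T([X, Y], Z) - T(Y, [X, Z]) evaluated on the *)
(* coordinate fields.                                                         *)
Definition lie_derivative X T (x : 'rV[R]_n) : 'M[R]_n :=
  \matrix_(a, b)
    ('D_(X x) (fun y => T y a b) x
     - bil (T x) (bracket X (cst (evec R a)) x) (evec R b)
     - bil (T x) (evec R a) (bracket X (cst (evec R b)) x)).

(* Koszul's formula for constant fields u, v: the Levi-Civita derivative of   *)
(* the constant field v in the direction u.                                   *)
Definition christoffel g (x u v : 'rV[R]_n) : 'rV[R]_n :=
  2^-1 *: ((v *m 'D_u g x + u *m 'D_v g x
            - \row_l bil ('D_(evec R l) g x) u v) *m invmx (g x)).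

Definition nabla g X Y (x : 'rV[R]_n) : 'rV[R]_n :=
  'D_(X x) Y x + christoffel g x (X x) (Y x).

Definition curvature g X Y Z (x : 'rV[R]_n) : 'rV[R]_n :=
  nabla g X (nabla g Y Z) x - nabla g Y (nabla g X Z) x
  - nabla g (bracket X Y) Z x.

Definition ricci g (x v w : 'rV[R]_n) : R :=
  \sum_(i < n) curvature g (cst (evec R i)) (cst v) (cst w) x 0 i.

Definition scalar_curvature g (x : 'rV[R]_n) : R :=
  \sum_(j < n) \sum_(k < n) invmx (g x) j k * ricci g x (evec R j) (evec R k).

End LocalGeometry.

(* The Christoffel symbols above are the only ones that define a torsion-free *)
(* connection preserving the metric.                                          *)
Section LeviCivita.
Variables (R : realType) (n : nat).
Implicit Types (B : 'M[R]_n) (u v w : 'rV[R]_n).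

Lemma bilC B u v : B^T = B -> bil B u v = bil B v u.
Proof.
move=> sB; have -> : bil B u v = ((u *m B *m v^T)^T) 0 0 by rewrite mxE.
by rewrite !trmx_mul trmxK sB mulmxA.
Qed.

Lemma bil_evec B u l : bil B u (evec R l) = (u *m B) 0 l.
Proof. by rewrite /bil /evec trmx_delta -colE mxE. Qed.

Lemma bil_suml B u v : bil B u v = \sum_l v 0 l * bil B u (evec R l).
Proof.
rewrite [LHS]mxE; apply: eq_bigr => l _; rewrite bil_evec mulrC; congr (_ * _).
by rewrite mxE.
Qed.

Lemma derive_metric_sym (g : 'rV[R]_n -> 'M[R]_n) (x w : 'rV[R]_n) :
  (\forall y \near x, (g y)^T = g y) -> differentiable g x ->
  ('D_w g x)^T = 'D_w g x.
Proof.
move=> gs dg; have dw : derivable g x w by exact: diff_derivable.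
rewrite (derive_mx dw); apply/matrixP => a b; rewrite !mxE.
apply: near_eq_derive; near=> y.
have gy : (g y)^T = g y by near: y.
by rewrite -[in LHS]gy mxE.
Unshelve. all: by end_near. Qed.

Lemma christoffelE (g : 'rV[R]_n -> 'M[R]_n) (x u v : 'rV[R]_n) l :
  g x \in unitmx ->
  (christoffel g x u v *m g x) 0 l =
  2^-1 * (bil ('D_u g x) v (evec R l) + bil ('D_v g x) u (evec R l)
          - bil ('D_(evec R l) g x) u v).
Proof.
move=> gU; rewrite /christoffel -scalemxAl mulmxKV// mxE; congr (_ * _).
by rewrite mxE [X in X + _]mxE !bil_evec; congr (_ + _); rewrite !mxE.
Qed.

Lemma christoffelP (g : 'rV[R]_n -> 'M[R]_n) (x : 'rV[R]_n)
    (G : 'rV[R]_n -> 'rV[R]_n -> 'rV[R]_n) :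
  (\forall y \near x, (g y)^T = g y) -> differentiable g x ->
  g x \in unitmx ->
  ((forall u v, G u v = G v u) /\
   (forall w u v, bil ('D_w g x) u v =
      bil (g x) (G w u) v + bil (g x) u (G w v)))
  <-> (forall u v, G u v = christoffel g x u v).
Proof.
move=> gs dg gU.
have gxs : (g x)^T = g x by exact: nbhs_singleton gs.
have Ds w : ('D_w g x)^T = 'D_w g x by exact: derive_metric_sym.
split=> [[Gs Gm] u v|GE].
  apply: (can_inj (mulmxK gU)); apply/rowP => l.
  rewrite christoffelE// -bil_evec.
  have := Gm u v (evec R l); have := Gm v u (evec R l).
  have := Gm (evec R l) u v.
  rewrite (Gs v u) (Gs (evec R l) u) (Gs (evec R l) v) => -> -> ->.
  rewrite (bilC (G u _) v gxs).
  set a := bil _ (G u v) _; set b := bil _ _ _; set c := bil _ _ _.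
  by field.
have K w u v : bil (g x) (christoffel g x w u) v = 
    2^-1 * (bil ('D_w g x) u v + bil ('D_u g x) w v - bil ('D_v g x) w u).
  have Dv : bil ('D_v g x) w u = \sum_l v 0 l * bil ('D_(evec R l) g x) w u.
    rewrite deriveE// {1}(row_sum_delta v) linear_sum /bil mulmx_sumr mulmx_suml summxE.
    apply: eq_bigr => l _; rewrite linearZ/= -scalemxAr -scalemxAl mxE.
    by rewrite deriveE.
  rewrite Dv bil_suml [bil ('D_w g x) u v]bil_suml [bil ('D_u g x) w v]bil_suml.
  rewrite -big_split/= -sumrB mulr_sumr; apply: eq_bigr => l _.
  by rewrite [in LHS]bil_evec christoffelE//; ring.
split=> [u v|w u v]; rewrite !GE.
  rewrite /christoffel; congr (_ *: (_ *m _)); rewrite [_ *m _ + _]addrC.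
  by congr (_ - _); apply/rowP => l; rewrite !mxE bilC.
rewrite [bil (g x) u _]bilC// !K (bilC v u)//.
by field.
Qed.

End LeviCivita.

Section Submanifolds.
Variable R : realType.

Section Intrinsic.
Variables (n : nat) (M : smooth_manifold R n) (g : riemannian_metric M).

Definition concurrent (zeta : vector_field M) : Prop :=
  forall (i : index M) x (u : 'rV[R]_n), img i x ->
    nabla (g i) (cst u) (zeta i) x = u.

Definition hyperbolic_yamabe_soliton (xi : vector_field M) (lambda mu : R) :
    Prop :=
  forall (i : index M) x, img i x ->
    lie_derivative (xi i) (lie_derivative (xi i) (g i)) x
    + lambda *: lie_derivative (xi i) (g i) x
    = (mu - scalar_curvature (g i) x) *: g i x.

Definition constant_scalar_curvature : Prop :=
  exists c : R, forall (i : index M) x, img i x ->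
    scalar_curvature (g i) x = c.

(* (nabla_u A) w = nabla_u (A w) - A (nabla_u w) for constant w.              *)
Definition parallel_endo (A : endo_field M) : Prop :=
  forall (i : index M) x (u w : 'rV[R]_n), img i x ->
    nabla (g i) (cst u) (fun y => w *m A i y) x
    - nabla (g i) (cst u) (cst w) x *m A i x = 0.

Definition metallic_endo (A : endo_field M) : Prop :=
  exists a b : R, forall (i : index M) x, img i x ->
    A i x *m A i x = a *: A i x + b%:M.

End Intrinsic.

Section Immersion.
Variables (n m : nat) (M : smooth_manifold R n) (N : smooth_manifold R m).
Variables (f : M -> N) (g : riemannian_metric M) (gN : riemannian_metric N).

Definition local_dom (i : index M) (j : index N) : set 'rV[R]_n :=
  [set x | img i x /\ dom j (f (param i x))].

Definition local_map (i : index M) (j : index N) (x : 'rV[R]_n) : 'rV[R]_m :=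
  coord j (f (param i x)).

Definition smooth_map : Prop :=
  continuous f /\ forall i j, smooth_on (local_dom i j) (local_map i j).

Definition immersion : Prop :=
  smooth_map /\ forall i j x, local_dom i j x ->
    injective (fun u : 'rV[R]_n => 'D_u (local_map i j) x).

Definition isometric_immersion : Prop :=
  immersion /\ forall i j x (u v : 'rV[R]_n), local_dom i j x ->
    bil (g i x) u v =
    bil (gN j (local_map i j x)) ('D_u (local_map i j) x)
      ('D_v (local_map i j) x).

Definition normal_vector i j (x : 'rV[R]_n) (w : 'rV[R]_m) : Prop :=
  forall u : 'rV[R]_n, bil (gN j (local_map i j x)) w
    ('D_u (local_map i j) x) = 0.

(* Vector fields along f are given, in a chart i of M and a chart j of N, by  *)
(* functions on local_dom i j.                                                *)
Definition nabla_along i j (u : 'rV[R]_n) (V : 'rV[R]_n -> 'rV[R]_m)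
    (x : 'rV[R]_n) : 'rV[R]_m :=
  'D_u V x + christoffel (gN j) (local_map i j x) ('D_u (local_map i j) x) (V x).

(* zeta along f, minus the image under df of the vector field xi.             *)
Definition complement_part (zeta : vector_field N) (xi : vector_field M) i j
    (x : 'rV[R]_n) : 'rV[R]_m :=
  zeta j (local_map i j x) - 'D_(xi i x) (local_map i j) x.

(* xi is the tangential component of zeta; the normal component is then       *)
(* complement_part zeta xi.                                                   *)
Definition tangential_component (zeta : vector_field N) (xi : vector_field M) :
    Prop :=
  forall i j x, local_dom i j x ->
    normal_vector i j x (complement_part zeta xi i j x).

(* Weingarten formula: the derivative of V along u is - A u + normal.         *)
Definition shape_operator
    (V : index M -> index N -> 'rV[R]_n -> 'rV[R]_m) (A : endo_field M) : Prop :=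
  forall i j x (u : 'rV[R]_n), local_dom i j x ->
    exists2 w, normal_vector i j x w &
      nabla_along i j u (V i j) x = - 'D_(u *m A i x) (local_map i j) x + w.

End Immersion.
End Submanifolds.

(* Main.v *)
Require Import Defs.
From mathcomp Require Import all_boot all_order all_algebra.
From mathcomp Require Import all_classical all_reals all_analysis.
From mathcomp Require Import ring lra.
Set Implicit Arguments.
Unset Strict Implicit.
Unset Printing Implicit Defensive.
Import Order.TTheory GRing.Theory Num.Theory.
Import numFieldNormedType.Exports.
Local Open Scope classical_set_scope.
Local Open Scope ring_scope.

(** Write xi for the tangential part of zeta, nu for its normal part, A for the
    shape operator of nu and B = 1 + A.

    Extrinsic geometry. Differentiating <zeta, dF w> = g(xi, w) along the
    immersion F, concurrency turns the derivative of zeta into dF u, and the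
    Gauss formula absorbs the Christoffel terms of g; what is left is
    g(nabla_u xi, w) = g(u, w) + <nu, D_u dF w>. Differentiating <nu, dF w> = 0
    identifies the last term as g(A u, w). Hence nabla_u xi = B u
    ([nabla_tangential]), and A is self-adjoint because D_u dF w is symmetric
    in u and w ([shape_selfadjoint]); this symmetry is the commutation of
    second partial derivatives ([smooth_derive_commutes]).

    Soliton equation. If a bilinear form T is parallel along xi, then
    L_xi T = T(B., .) + T(., B.) ([lie_derivative_parallel]). The metric is
    parallel, and so is g(B., .) because A is; self-adjointness of A then gives
    L_xi g = 2 g(B., .) and L_xi L_xi g = 4 g(B^2., .). The soliton equation
    becomes 4 B^2 + 2 lambda B = (mu - r) 1 ([shape_equation]).

    Conclusion. When r is constant this is a metallic equation for A. In the
    other direction, subtracting a given metallic equation A^2 = a A + b leaves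
    (4 a + 8 + 2 lambda) A = (scalar affine in r) 1. If the coefficient
    vanishes, r is constant. Otherwise A is a scalar multiple of the identity
    at every point; being parallel, the factor is locally constant, hence
    constant on the connected M ([parallel_scalar_constant]), and so is r. *)

(** * Differential calculus on row and matrix spaces *)

Section Smooth.
Variables (R : realType) (n : nat) (W : normedModType R).
Implicit Types (U : set 'rV[R]_n) (F : 'rV[R]_n -> W).

Lemma smooth_on_differentiable U F x :
  smooth_on U F -> U x -> differentiable F x.
Proof. by move=> /(_ 1%N)[dF _] /dF. Qed.

Lemma smooth_on_derivable U F x v : smooth_on U F -> U x -> derivable F x v.
Proof. by move=> sF Ux; exact/diff_derivable/(smooth_on_differentiable sF). Qed.

Lemma smooth_on_derive U F v : smooth_on U F -> smooth_on U (fun x => 'D_v F x).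
Proof. by move=> sF k; have [_] := sF k.+1; exact. Qed.

Lemma smooth_on_subset U U' F : U' `<=` U -> smooth_on U F -> smooth_on U' F.
Proof.
move=> sU sF k; elim: k F {sF}(sF k) => [|k IH] F /=.
  by move=> cF x /sU; exact: cF.
by case=> dF DF; split=> [x /sU|v]; [exact: dF|exact: IH].
Qed.

Lemma deriveZr F x (k : R) v :
  differentiable F x -> 'D_(k *: v) F x = k *: 'D_v F x.
Proof. by move=> dF; rewrite !deriveE// linearZ. Qed.

End Smooth.

Lemma derive_chain (R : realType) (U V W : normedModType R)
    (F : U -> V) (G : V -> W) x u :
  differentiable F x -> differentiable G (F x) ->
  is_derive x u (fun y => G (F y)) ('D_('D_u F x) G (F x)).
Proof.
move=> dF dG; have dGF : differentiable (G \o F) x by exact: differentiable_comp.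
apply: DeriveDef; first exact: diff_derivable.
by rewrite deriveE// (diff_comp dF dG) /= !deriveE.
Qed.

Section MatrixDerivatives.
Variables (R : realType) (V : normedModType R).

Lemma is_derive_mxP m n (A : V -> 'M[R]_(m, n)) x v dA :
  is_derive x v A dA <-> forall i j, is_derive x v (fun y => A y i j) (dA i j).
Proof.
split=> [[dA1 <-] i j|h].
  apply: DeriveDef; first exact: (derivable_mxP A x v).1.
  by rewrite derive_mx// mxE.
have dA1 : derivable A x v by apply/derivable_mxP => i j; case: (h i j).
apply: DeriveDef => //; rewrite derive_mx//; apply/matrixP => i j.
by rewrite mxE; case: (h i j).
Qed.

Lemma is_derive_mulmx m n p (A : V -> 'M[R]_(m, n)) (B : V -> 'M[R]_(n, p))
    x v dA dB :
  is_derive x v A dA -> is_derive x v B dB ->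
  is_derive x v (fun y => A y *m B y) (dA *m B x + A x *m dB).
Proof.
move=> /is_derive_mxP hA /is_derive_mxP hB; apply/is_derive_mxP => i j.
rewrite (_ : (fun _ => _) = \sum_k (fun y => A y i k * B y k j)); last first.
  by apply/funext => y; rewrite mxE fct_sumE.
have h k : is_derive x v (fun y => A y i k * B y k j)
    (dA i k * B x k j + A x i k * dB k j).
  have := is_deriveM (hA i k) (hB k j); move/is_derive_eq; apply.
  by rewrite addrC; congr (_ + _); rewrite /GRing.scale/= mulrC.
by apply: (is_derive_eq (is_derive_sum h)); rewrite big_split/= !mxE.
Qed.

Lemma is_derive_trmx m n (A : V -> 'M[R]_(m, n)) x v dA :
  is_derive x v A dA -> is_derive x v (fun y => (A y)^T) dA^T.
Proof.
move=> /is_derive_mxP hA; apply/is_derive_mxP => i j; rewrite mxE.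
by under eq_fun do rewrite mxE.
Qed.

Lemma is_derive_bil n (B : V -> 'M[R]_n) (X Y : V -> 'rV[R]_n) x v dB dX dY :
  is_derive x v B dB -> is_derive x v X dX -> is_derive x v Y dY ->
  is_derive x v (fun y => bil (B y) (X y) (Y y))
    (bil dB (X x) (Y x) + bil (B x) dX (Y x) + bil (B x) (X x) dY).
Proof.
move=> hB hX hY.
have := is_derive_mulmx (is_derive_mulmx hX hB) (is_derive_trmx hY).
move=> /is_derive_mxP/(_ 0 0)/is_derive_eq; apply.
by rewrite mulmxDl /bil mxE [X in X + _]mxE [X in X + _ = _]addrC.
Qed.

End MatrixDerivatives.

Section Lines.
Variables (R : realType) (V : normedModType R).

Lemma is_derive_line (f : V -> R) x u s : derivable f (s *: u + x) u ->
  is_derive s 1 (fun t : R => f (t *: u + x)) ('D_u f (s *: u + x)).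
Proof.
have e : (fun h : R => h^-1 *: (f ((h *: 1 + s) *: u + x) - f (s *: u + x)))
    = (fun h : R => h^-1 *: (f (h *: u + (s *: u + x)) - f (s *: u + x))).
  by apply/funext => h; rewrite [h%:A]mulr1 scalerDl -addrA.
by move=> df; apply: DeriveDef; rewrite /derivable /derive/= e.
Qed.

Lemma MVT_line (f : V -> R) x u h : 0 <= h ->
  (forall s, s \in `[0, h]%R -> derivable f (s *: u + x) u) ->
  exists2 s, s \in `[0, h]%R & f (h *: u + x) - f x = 'D_u f (s *: u + x) * h.
Proof.
move=> h0 df.
have [s|s|s sh E] := @MVT_segment R (fun t => f (t *: u + x))
    (fun t => 'D_u f (t *: u + x)) 0 h h0.
- by move=> /subset_itv_oo_cc/df; exact: is_derive_line.
- apply: continuous_in_subspaceT => t; rewrite inE/= => /df/is_derive_line[d _].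
  exact/differentiable_continuous/derivable1_diffP.
- by exists s => //; move: E; rewrite scale0r add0r subr0.
Qed.

Lemma nbhs_parallelogram (x u v : V) (P : set V) : nbhs x P ->
  exists2 h : R, 0 < h & forall s t, s \in `[0, h]%R -> t \in `[0, h]%R ->
    P (s *: u + (t *: v + x)).
Proof.
move=> /nbhs_ballP[r /= r0 rP].
have c0 : 0 < `|u| + `|v| + 1 by rewrite ltr_wpDl// addr_ge0.
have h0 : 0 < r / 2 / (`|u| + `|v| + 1) by rewrite !divr_gt0.
exists (r / 2 / (`|u| + `|v| + 1)) => // s t.
rewrite !in_itv/= => /andP[s0 sh] /andP[t0 th].
apply: rP; rewrite -ball_normE/= distrC addrA addrK.
apply: (@le_lt_trans _ _ (r / 2)); last by rewrite ltr_pdivrMr// ltr_pMr// ltr1n.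
have hE : r / 2 / (`|u| + `|v| + 1) * (`|u| + `|v| + 1) = r / 2.
  by rewrite divfK// gt_eqF.
rewrite (le_trans (ler_normD _ _))// !normrZ !ger0_norm// -hE.
by rewrite 2!mulrDr mulr1 ler_wpDr ?(ltW h0)// lerD// ler_wpM2r.
Qed.

(** The mean value theorem is used twice: along u for the increment
    y |-> f (h v + y) - f y, then along v for 'D_u f. *)
Lemma second_difference (f : V -> R) (x u v : V) (P : set V) (h : R) : 0 <= h ->
  (forall s t, s \in `[0, h]%R -> t \in `[0, h]%R ->
     P (s *: u + (t *: v + x))) ->
  (forall y, P y -> derivable f y u /\ derivable (fun z => 'D_u f z) y v) ->
  exists2 y, P y & f (h *: u + (h *: v + x)) - f (h *: u + x)
    - (f (h *: v + x) - f x) = 'D_v (fun z => 'D_u f z) y * h * h.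
Proof.
move=> h0 hP dP.
have i0 : 0 \in `[0, h]%R by rewrite in_itv/= lexx.
have ih : h \in `[0, h]%R by rewrite in_itv/= lexx h0.
pose F := (fun y => f (h *: v + y)) - f.
have dF s : s \in `[0, h]%R -> is_derive (s *: u + x) u F
    ('D_u f (s *: u + (h *: v + x)) - 'D_u f (s *: u + x)).
  move=> sh; apply: is_deriveB; last first.
    by apply: derivableP; have := (dP _ (hP s 0 sh i0)).1; rewrite scale0r add0r.
  have := (dP _ (hP s h sh ih)).1; rewrite addrCA => d.
  have e : (fun k : R => k^-1 *: (f (h *: v + (k *: u + (s *: u + x)))
                                - f (h *: v + (s *: u + x))))
    = (fun k : R => k^-1 *: (f (k *: u + (h *: v + (s *: u + x)))
                                - f (h *: v + (s *: u + x)))).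
    by apply/funext => k; rewrite [h *: v + (k *: u + _)]addrCA.
  by apply: DeriveDef; rewrite /derivable /derive e.
have [|s sh] := @MVT_line F x u h h0; first by move=> s /dF[].
have FE y : F y = f (h *: v + y) - f y by [].
rewrite !FE.
have [_ ->] := dF _ sh.
have [|t th] := @MVT_line (fun z => 'D_u f z) (s *: u + x) v h h0.
  by move=> t th; have := (dP _ (hP s t sh th)).2; rewrite addrCA.
rewrite [h *: v + (s *: u + x)]addrCA => -> E.
exists (s *: u + (t *: v + x)); first exact: hP.
by rewrite [h *: u + (h *: v + x)]addrCA [s *: u + (t *: v + x)]addrCA; exact: E.
Qed.

(** The second difference of f over a small parallelogram is symmetric in its
    two sides, and it is h^2 times either mixed derivative at some point of the
    parallelogram; by continuity the two mixed derivatives agree at x. *)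
Lemma derive_commutes (f : V -> R) (x u v : V) :
  (\forall y \near x, derivable f y u /\ derivable (fun z => 'D_u f z) y v) ->
  (\forall y \near x, derivable f y v /\ derivable (fun z => 'D_v f z) y u) ->
  {for x, continuous (fun y => 'D_v (fun z => 'D_u f z) y)} ->
  {for x, continuous (fun y => 'D_u (fun z => 'D_v f z) y)} ->
  'D_v (fun z => 'D_u f z) x = 'D_u (fun z => 'D_v f z) x.
Proof.
move=> nu nv cu cv; apply: contrapT => /eqP ne.
have cancel (p q k : R) : 0 < k -> p * k * k = q * k * k -> p = q.
  by move=> k0; do 2 (move/mulIf; rewrite gt_eqF// => /(_ isT)).
have swap (p q r s : R) : p - q - (r - s) = p - r - (q - s) by ring.
have apart (p q r : R) : p != q ->
    `|p - r| < `|p - q| / 2 -> `|q - r| < `|p - q| / 2 -> False.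
  move=> pq pr qr; suff : `|p - q| < `|p - q| by rewrite ltxx.
  rewrite [ltRHS]splitr (le_lt_trans (ler_distD r _ _))// ltrD//.
  by rewrite distrC.
set a := 'D_v _ x in ne *; set b := 'D_u _ x in ne *.
pose e := `|a - b| / 2.
have e0 : 0 < e by rewrite divr_gt0// normr_gt0 subr_eq0.
pose P := [set y | (derivable f y u /\ derivable (fun z => 'D_u f z) y v) /\
   `|a - 'D_v (fun z => 'D_u f z) y| < e].
pose Q := [set y | (derivable f y v /\ derivable (fun z => 'D_v f z) y u) /\
   `|b - 'D_u (fun z => 'D_v f z) y| < e].
have nP : nbhs x P by apply: filterI; [exact: nu|exact: (cvgrPdist_lt _ _).1 cu e e0].
have nQ : nbhs x Q by apply: filterI; [exact: nv|exact: (cvgrPdist_lt _ _).1 cv e e0].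
have [h h0 hPQ] := nbhs_parallelogram u v (filterI nP nQ).
have [||y [_ ay] Ey] := @second_difference f x u v P h (ltW h0).
- by move=> s t sh th; have [] := hPQ _ _ sh th.
- by move=> y [].
have [||z [_ bz] Ez] := @second_difference f x v u Q h (ltW h0).
- by move=> s t sh th; rewrite addrCA; have [_] := hPQ _ _ th sh.
- by move=> y' [].
move: Ez; rewrite [h *: v + (h *: u + x)]addrCA swap Ey.
by move=> /(cancel _ _ _ h0) yz; apply: (apart _ _ _ ne ay); rewrite yz.
Qed.

End Lines.

Lemma open_near (T : topologicalType) (U : set T) x (P : T -> Prop) :
  open U -> U x -> (forall y, U y -> P y) -> \forall y \near x, P y.
Proof. by move=> oU Ux h; apply: filterS (open_nbhs_nbhs (conj oU Ux)). Qed.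

Section SmoothMatrix.
Variables (R : realType) (n p q : nat).
Variables (U : set 'rV[R]_n) (F : 'rV[R]_n -> 'M[R]_(p, q)).
Hypotheses (oU : open U) (sF : smooth_on U F).

Let derive_entry i j x u : U x ->
  derivable (fun y => F y i j) x u /\
  'D_u (fun y => F y i j) x = ('D_u F x) i j.
Proof.
move=> Ux; have d : derivable F x u by exact: smooth_on_derivable sF Ux.
by split; [exact/(derivable_mxP _ _ _).1|rewrite derive_mx// mxE].
Qed.

Let derive2_entry i j x u v : U x ->
  derivable ('D_u (fun y => F y i j)) x v /\
  'D_v ('D_u (fun y => F y i j)) x = ('D_v ('D_u F) x) i j.
Proof.
move=> Ux; have d : derivable (fun y => 'D_u F y) x v.
  exact: smooth_on_derivable (smooth_on_derive u sF) Ux.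
have e : \forall y \near x,
    (fun y => ('D_u F y) i j) y = 'D_u (fun y => F y i j) y.
  by apply: (open_near oU Ux) => y Uy; rewrite (derive_entry i j u Uy).2.
split; first by apply: near_eq_derivable e _; exact/(derivable_mxP _ _ _).1.
by rewrite -(near_eq_derive _ e) derive_mx// mxE.
Qed.

Lemma smooth_derive_commutes x u v : U x ->
  'D_u (fun y => 'D_v F y) x = 'D_v (fun y => 'D_u F y) x.
Proof.
move=> Ux; apply/matrixP => i j.
apply: etrans (esym (derive2_entry i j v u Ux).2) _.
apply: etrans _ (derive2_entry i j u v Ux).2.
have c a b : {for x, continuous ('D_b ('D_a (fun y => F y i j)))}.
  have s2 : smooth_on U ('D_b ('D_a F)) by do 2 apply: smooth_on_derive.
  have e : \forall y \near x,
      ('D_b ('D_a F) y) i j = 'D_b ('D_a (fun y => F y i j)) y.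
    by apply: (open_near oU Ux) => y Uy; rewrite (derive2_entry i j a b Uy).2.
  rewrite /prop_for /continuous_at (derive2_entry _ _ _ _ Ux).2.
  apply: cvg_trans (near_eq_cvg e) _.
  apply: (@continuous_comp _ _ _ ('D_b ('D_a F)) (fun M : 'M[R]_(p, q) => M i j)).
    exact: s2 0%N _ Ux.
  exact: coord_continuous.
apply: derive_commutes; [| |exact: c|exact: c].
- apply: (open_near oU Ux) => y Uy.
  by split; [case: (derive_entry i j v Uy)|case: (derive2_entry i j v u Uy)].
- apply: (open_near oU Ux) => y Uy.
  by split; [case: (derive_entry i j u Uy)|case: (derive2_entry i j u v Uy)].
Qed.

End SmoothMatrix.

Lemma derive0_ball_constant (R : realType) (V : normedModType R) (F : V -> R)
    x r :
  (forall y u, ball x r y -> is_derive y u F 0) ->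
  forall y, ball x r y -> F y = F x.
Proof.
move=> dF y xy.
have inb s : s \in `[0, 1]%R -> ball x r (s *: (y - x) + x).
  rewrite in_itv/= => /andP[s0 s1]; move: xy; rewrite -!ball_normE/= => xy.
  rewrite opprD addrCA subrr addr0 normrN normrZ ger0_norm// distrC.
  by apply: le_lt_trans xy; rewrite ler_piMl.
have [|s sI] := @MVT_line R V F x (y - x) 1 ler01.
  by move=> s /inb/(dF _ (y - x))[].
have [_ ->] := dF _ (y - x) (inb _ sI).
by rewrite scale1r subrK mul0r => /subr0_eq.
Qed.

Lemma locally_constant (T : topologicalType) (Y : Type) (h : T -> Y) :
  connected [set: T] -> (forall p, \forall q \near p, h q = h p) ->
  forall p q, h p = h q.
Proof.
move=> cT lc p q; pose B := [set s | h s = h p].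
have oB : open B.
  by rewrite openE => s /= hs; apply: filterS (lc s) => t; rewrite /B/= hs.
have cB : closed B.
  rewrite -openC openE => s /= hs; apply: filterS (lc s) => t.
  by rewrite /B/= => ->.
have BT : B = [set: T].
  apply: cT; first by exists p.
  - by exists B => //; rewrite setTI.
  - by exists B => //; rewrite setTI.
by have : B q by rewrite BT.
Qed.

(** * Bilinear forms as matrices *)

Section Bil.
Variables (R : realType) (n : nat).
Implicit Types (B : 'M[R]_n) (u v : 'rV[R]_n).

Lemma bilDl B u v w : bil B (u + v) w = bil B u w + bil B v w.
Proof. by rewrite /bil !mulmxDl mxE. Qed.

Lemma bilDr B u v w : bil B w (u + v) = bil B w u + bil B w v.
Proof. by rewrite /bil linearD mulmxDr mxE. Qed.

Lemma bilNl B u w : bil B (- u) w = - bil B u w.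
Proof. by rewrite /bil !mulNmx mxE. Qed.

Lemma bilNr B u w : bil B w (- u) = - bil B w u.
Proof. by rewrite /bil linearN mulmxN mxE. Qed.

Lemma bilZ (k : R) B u w : bil (k *: B) u w = k * bil B u w.
Proof. by rewrite /bil -scalemxAr -scalemxAl mxE. Qed.

Lemma bilZr (k : R) B u w : bil B w (k *: u) = k * bil B w u.
Proof. by rewrite /bil linearZ/= -scalemxAr mxE. Qed.

Lemma bilD B C u w : bil (B + C) u w = bil B u w + bil C u w.
Proof. by rewrite /bil mulmxDr mulmxDl mxE. Qed.

Lemma bilMl B M u v : bil (M *m B) u v = bil B (u *m M) v.
Proof. by rewrite /bil mulmxA. Qed.

Lemma bilMr B M u v : bil (B *m M^T) u v = bil B u (v *m M).
Proof. by rewrite /bil trmx_mul !mulmxA. Qed.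

Lemma bil0l B w : bil B 0 w = 0.
Proof. by rewrite /bil !mul0mx mxE. Qed.

Lemma bil0r B w : bil B w 0 = 0.
Proof. by rewrite /bil trmx0 mulmx0 mxE. Qed.

Lemma bil_entry B i j : bil B (evec R i) (evec R j) = B i j.
Proof. by rewrite bil_evec -rowE mxE. Qed.

Lemma bil_inj B C : (forall u v, bil B u v = bil C u v) -> B = C.
Proof. by move=> h; apply/matrixP => i j; rewrite -!bil_entry h. Qed.

Lemma bil_nondegenerate B u v : B \in unitmx ->
  (forall w, bil B u w = bil B v w) -> u = v.
Proof.
move=> Bu h; apply: (can_inj (mulmxK Bu)); apply/rowP => l.
by rewrite -!bil_evec h.
Qed.

Lemma posdef_unitmx B : (forall u, u != 0 -> 0 < bil B u u) -> B \in unitmx.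
Proof.
move=> pB; rewrite -row_free_unit -kermx_eq0; apply/eqP/row_matrixP => i.
rewrite row0; apply: contrapT => /eqP/pB.
by rewrite /bil -row_mul mulmx_ker row0 mul0mx mxE ltxx.
Qed.

End Bil.

(** * Connections and covariant derivatives *)

Lemma christoffelZr (R : realType) n (g : 'rV[R]_n -> 'M[R]_n) x u v (k : R) :
  differentiable g x -> christoffel g x u (k *: v) = k *: christoffel g x u v.
Proof.
move=> dg; rewrite /christoffel deriveZr// scalerA mulrC -scalerA; congr (_ *: _).
rewrite scalemxAl; congr (_ *m _); rewrite scalerBr scalerDr.
rewrite -scalemxAl -scalemxAr; congr (_ - _); apply/rowP => l.
by rewrite [LHS]mxE bilZr [RHS]mxE [X in _ = _ * X]mxE.
Qed.

Lemma levi_civita (R : realType) n (U : set 'rV[R]_n) (g : 'rV[R]_n -> 'M[R]_n)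
    x : open U -> smooth_on U g -> (forall y, U y -> (g y)^T = g y) ->
    (forall y, U y -> g y \in unitmx) -> U x ->
  (forall u v, christoffel g x u v = christoffel g x v u) /\
  (forall w u v, bil ('D_w g x) u v =
    bil (g x) (christoffel g x w u) v + bil (g x) u (christoffel g x w v)).
Proof.
move=> oU sg symg unitg Ux.
apply: (christoffelP (christoffel g x) _ _ (unitg _ Ux)).2 => //.
- exact: (open_near oU Ux symg).
- exact: smooth_on_differentiable sg Ux.
Qed.

Section AlongMap.
Variables (R : realType) (n m : nat) (U : set 'rV[R]_n) (V : set 'rV[R]_m).
Variables (F : 'rV[R]_n -> 'rV[R]_m) (G : 'rV[R]_m -> 'M[R]_m).
Hypotheses (oU : open U) (oV : open V) (FV : forall x, U x -> V (F x)).
Hypotheses (sF : smooth_on U F) (sG : smooth_on V G).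
Hypothesis symG : forall y, V y -> (G y)^T = G y.
Hypothesis unitG : forall y, V y -> G y \in unitmx.

(** The pullback of the Levi-Civita connection of G by F, acting on vector
    fields W along F. *)
Definition cov (u : 'rV[R]_n) (W : 'rV[R]_n -> 'rV[R]_m) (x : 'rV[R]_n) :
    'rV[R]_m :=
  'D_u W x + christoffel G (F x) ('D_u F x) (W x).

Lemma is_derive_metric_along x u W1 W2 : U x ->
  derivable W1 x u -> derivable W2 x u ->
  is_derive x u (fun y => bil (G (F y)) (W1 y) (W2 y))
    (bil (G (F x)) (cov u W1 x) (W2 x) + bil (G (F x)) (W1 x) (cov u W2 x)).
Proof.
move=> Ux /derivableP d1 /derivableP d2.
have dG := derive_chain u (smooth_on_differentiable sF Ux)
  (smooth_on_differentiable sG (FV Ux)).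
apply: (is_derive_eq (is_derive_bil dG d1 d2)).
rewrite (levi_civita oV sG symG unitG (FV Ux)).2 /cov bilDl bilDr.
by ring.
Qed.

Lemma cov_partial_sym x u v : U x ->
  cov u (fun y => 'D_v F y) x = cov v (fun y => 'D_u F y) x.
Proof.
move=> Ux; rewrite /cov.
have E := smooth_derive_commutes oU sF u v Ux.
have [Gs _] := levi_civita oV sG symG unitG (FV Ux).
exact: (f_equal2 +%R E (Gs ('D_u F x) ('D_v F x))).
Qed.

Variable g : 'rV[R]_n -> 'M[R]_n.
Hypotheses (sg : smooth_on U g) (symg : forall x, U x -> (g x)^T = g x).
Hypothesis unitg : forall x, U x -> g x \in unitmx.
Hypothesis isoF : forall x u v, U x ->
  bil (g x) u v = bil (G (F x)) ('D_u F x) ('D_v F x).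

(** The tangential part of D_u dF v, read in the metric g, is symmetric in u and
    v and compatible with g, so it is the Levi-Civita connection of g by
    uniqueness. *)
Lemma gauss_formula x u v w : U x ->
  bil (G (F x)) (cov u (fun y => 'D_v F y) x) ('D_w F x) =
  bil (g x) (christoffel g x u v) w.
Proof.
move=> Ux.
pose k W : 'rV[R]_n := \row_l bil (G (F x)) W ('D_(evec R l) F x).
(* the covector dual to the tangential part of D_u dF v; multiplying it by
   invmx (g x) turns it into the vector itself *)
pose h u v := k (cov u (fun y => 'D_v F y) x).
have dF := smooth_on_differentiable sF Ux.
have hE a b c : bil (g x) (h a b *m invmx (g x)) c =
    bil (G (F x)) (cov a (fun y => 'D_b F y) x) ('D_c F x).
  rewrite bil_suml deriveEjacobian// [in RHS](row_sum_delta c).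
  rewrite mulmx_suml /bil linear_sum mulmx_sumr summxE; apply: eq_bigr => l _.
  rewrite -/(bil (g x) _ _) bil_evec mulmxKV ?unitg// mxE.
  by rewrite -scalemxAl linearZ/= -scalemxAr mxE /bil deriveEjacobian.
rewrite -hE; congr bil.
suff : forall a b, h a b *m invmx (g x) = christoffel g x a b by apply.
apply: (christoffelP _ (open_near oU Ux symg)
  (smooth_on_differentiable sg Ux) (unitg Ux)).1.
split=> [a b|a b c].
  exact: (congr1 (fun W => k W *m invmx (g x)) (cov_partial_sym a b Ux)).
have dd b' : derivable (fun y => 'D_b' F y) x a.
  exact: smooth_on_derivable (smooth_on_derive b' sF) Ux.
have [_ E] := is_derive_metric_along Ux (dd b) (dd c).
have /derivableP dg : derivable g x a by exact: smooth_on_derivable sg Ux.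
have [_ E'] := is_derive_bil dg (is_derive_cst b x a) (is_derive_cst c x a).
have E1 : bil ('D_a g x) b c = 'D_a (fun y => bil (g y) b c) x.
  by rewrite E' bil0l bil0r !addr0.
have E2 : 'D_a (fun y => bil (g y) b c) x =
    'D_a (fun y => bil (G (F y)) ('D_b F y) ('D_c F y)) x.
  by apply: near_eq_derive; apply: (open_near oU Ux) => y Uy; exact: isoF.
have E4 := etrans (bilC b (h a c *m invmx (g x)) (symg Ux))
  (etrans (hE a c b) (bilC _ _ (symG (FV Ux)))).
exact: etrans E1 (etrans E2 (etrans E (esym (f_equal2 +%R (hE a b c) E4)))).
Qed.

Variables (Z : 'rV[R]_m -> 'rV[R]_m) (xi : 'rV[R]_n -> 'rV[R]_n).
Variable A : 'rV[R]_n -> 'M[R]_n.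
Hypotheses (sZ : smooth_on V Z) (sxi : smooth_on U xi).
Hypothesis concurrentZ : forall y u, V y -> nabla G (cst u) Z y = u.
Let nu y := Z (F y) - 'D_(xi y) F y.
Hypothesis normal_nu : forall x w, U x ->
  bil (G (F x)) (nu x) ('D_w F x) = 0.
Hypothesis shapeA : forall x u w, U x ->
  bil (G (F x)) (cov u nu x) ('D_w F x) = - bil (g x) (u *m A x) w.

Let derivable_ZF x u : U x ->
  is_derive x u (fun y => Z (F y)) ('D_('D_u F x) Z (F x)).
Proof.
move=> Ux; apply: derive_chain; first exact: smooth_on_differentiable sF Ux.
exact: smooth_on_differentiable sZ (FV Ux).
Qed.

Let derivable_nu x u : U x -> derivable nu x u.
Proof.
move=> Ux; apply: derivableB; first by case: (derivable_ZF u Ux).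
(* the direction of 'D_(xi y) F y varies with y: differentiate the product of
   xi with the Jacobian instead *)
have e : \forall y \near x, xi y *m jacobian F y = 'D_(xi y) F y.
  apply: (open_near oU Ux) => y Uy.
  by rewrite deriveEjacobian//; exact: smooth_on_differentiable sF Uy.
apply: near_eq_derivable e _.
have /derivableP dxi : derivable xi x u by exact: smooth_on_derivable sxi Ux.
suff /derivableP dJ : derivable (jacobian F) x u.
  by case: (is_derive_mulmx dxi dJ).
apply/derivable_mxP => a b.
have e2 : \forall y \near x, ('D_(evec R a) F y) 0 b = jacobian F y a b.
  apply: (open_near oU Ux) => y Uy.
  rewrite deriveEjacobian; last exact: smooth_on_differentiable sF Uy.
  by rewrite -rowE mxE.
apply: near_eq_derivable e2 _.
apply: (derivable_mxP (fun y => 'D_(evec R a) F y) x u).1.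
exact: smooth_on_derivable (smooth_on_derive (evec R a) sF) Ux.
Qed.

(** The shape operator of nu against the second fundamental form: differentiate
    <nu, dF w> = 0 in the direction u. *)
Lemma shape_normal x u w : U x ->
  bil (g x) (u *m A x) w = bil (G (F x)) (nu x) (cov u (fun y => 'D_w F y) x).
Proof.
move=> Ux.
have dw : derivable (fun y => 'D_w F y) x u.
  exact: smooth_on_derivable (smooth_on_derive w sF) Ux.
have [_ E] := is_derive_metric_along Ux (derivable_nu (u := u) Ux) dw.
have E0 : 'D_u (fun y => bil (G (F y)) (nu y) ('D_w F y)) x = 0.
  rewrite -(derive_cst (0 : R) x u); apply: near_eq_derive.
  by apply: (open_near oU Ux) => y Uy; exact: normal_nu.
move: (etrans (esym E0) E); rewrite (shapeA u w Ux) => /esym/eqP.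
by rewrite addrC subr_eq0 => /eqP.
Qed.

Lemma shape_selfadjoint x : U x -> (A x *m g x)^T = A x *m g x.
Proof.
move=> Ux; apply: bil_inj => u v; rewrite bilMl shape_normal//.
rewrite (cov_partial_sym _ _ Ux) -shape_normal// trmx_mul symg//.
by rewrite bilMr bilC ?symg.
Qed.

(** Differentiate g(xi, w) = <Z o F, dF w> in the direction u: concurrency gives
    the identity, and [shape_normal] gives the shape operator. *)
Lemma nabla_tangential x u : U x -> nabla g (cst u) xi x = u + u *m A x.
Proof.
move=> Ux; apply: (bil_nondegenerate (unitg Ux)) => w.
have dF := smooth_on_differentiable sF Ux.
have dw : derivable (fun y => 'D_w F y) x u.
  exact: smooth_on_derivable (smooth_on_derive w sF) Ux.
have dZ := derivable_ZF u Ux.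
have [dZ1 EZ] := dZ.
have [_] := is_derive_metric_along Ux dZ1 dw.
have /derivableP dg : derivable g x u by exact: smooth_on_derivable sg Ux.
have /derivableP dxi : derivable xi x u by exact: smooth_on_derivable sxi Ux.
have [_ E'] := is_derive_bil dg dxi (is_derive_cst w x u).
have -> : 'D_u (fun y => bil (G (F y)) (Z (F y)) ('D_w F y)) x =
    'D_u (fun y => bil (g y) (xi y) w) x.
  apply: near_eq_derive; apply: (open_near oU Ux) => y Uy.
  rewrite isoF// -[Z (F y)](subrK ('D_(xi y) F y)) bilDl.
  by rewrite (normal_nu w Uy) add0r.
have -> : cov u (fun y => Z (F y)) x = 'D_u F x.
  by rewrite /cov EZ; exact: (concurrentZ ('D_u F x) (FV Ux)).
rewrite E' -isoF// bilDl shape_normal// /nu.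
rewrite bilDl bilNl.
rewrite [bil (G (F x)) ('D_(xi x) F x) _]bilC ?symG//; last exact: FV.
rewrite gauss_formula// [bil (g x) (christoffel _ _ _ _) (xi x)]bilC ?symg//.
have [_ lc] := levi_civita oU sg symg unitg Ux.
rewrite lc bil0r addr0.
rewrite /nabla bilDl.
set a := bil _ (christoffel _ _ _ _) _; set b := bil _ _ (christoffel _ _ _ _).
set c := bil _ ('D_u xi x) _; set d := bil _ u w; set e := bil _ _ (cov _ _ _).
move=> E; have -> : c + a = (a + b + c) - b by ring.
by rewrite E addrA.
Qed.

End AlongMap.

(** * The soliton equation in a chart *)

Section LieDerivative.
Variables (R : realType) (n : nat).
Implicit Types (X : 'rV[R]_n -> 'rV[R]_n) (g T : 'rV[R]_n -> 'M[R]_n).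

Lemma lie_derivative_near X T T' x : (\forall y \near x, T y = T' y) ->
  lie_derivative X T x = lie_derivative X T' x.
Proof.
move=> e; apply/matrixP => a b; rewrite !mxE (nbhs_singleton e).
do 2 congr (_ - _); apply: near_eq_derive.
by apply: filterS e => y ->.
Qed.

(** Since nabla X = P, the bracket [X, e] of X with a constant field e is
    Gamma(X, e) - e P; the Christoffel terms cancel against the derivative of T,
    which is parallel along X by the last hypothesis. *)
Lemma lie_derivative_parallel g X T x (P : 'M[R]_n) :
  derivable T x (X x) ->
  (forall u v, christoffel g x u v = christoffel g x v u) ->
  (forall u, nabla g (cst u) X x = u *m P) ->
  (forall a b, bil ('D_(X x) T x) a b =
     bil (T x) (christoffel g x (X x) a) b
     + bil (T x) a (christoffel g x (X x) b)) ->
  lie_derivative X T x = P *m T x + T x *m P^T.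
Proof.
move=> dT Gs nX pT; apply/matrixP => a b.
have br c : bracket X (cst (evec R c)) x =
    - (evec R c *m P) + christoffel g x (X x) (evec R c).
  by rewrite -nX /nabla /bracket derive_cst sub0r opprD Gs subrK.
have dE : 'D_(X x) (fun y => T y a b) x =
    bil ('D_(X x) T x) (evec R a) (evec R b).
  by rewrite bil_entry derive_mx// mxE.
rewrite [LHS]mxE dE pT !br [RHS]mxE.
rewrite -[(P *m _) a b]bil_entry -[(_ *m P^T) a b]bil_entry.
rewrite bilMl bilMr (bilDl (T x)) (bilDr (T x)) bilNl bilNr.
by ring.
Qed.

End LieDerivative.

Section Soliton.
Variables (R : realType) (n : nat) (U : set 'rV[R]_n).
Variables (g A : 'rV[R]_n -> 'M[R]_n) (xi : 'rV[R]_n -> 'rV[R]_n).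
Hypotheses (oU : open U) (sg : smooth_on U g) (sA : smooth_on U A).
Hypothesis symg : forall x, U x -> (g x)^T = g x.
Hypothesis unitg : forall x, U x -> g x \in unitmx.
Hypothesis nabla_xi : forall x u, U x -> nabla g (cst u) xi x = u + u *m A x.
Hypothesis adjA : forall x, U x -> (A x *m g x)^T = A x *m g x.
Hypothesis parA : forall x u w, U x ->
  nabla g (cst u) (fun y => w *m A y) x - nabla g (cst u) (cst w) x *m A x = 0.

Let B x : 'M[R]_n := 1%:M + A x.

Lemma derive_parallel_endo x u w : U x ->
  w *m 'D_u A x = christoffel g x u w *m A x - christoffel g x u (w *m A x).
Proof.
move=> Ux; have /derivableP dA : derivable A x u by exact: smooth_on_derivable sA Ux.
have [_ E] := is_derive_mulmx (is_derive_cst w x u) dA.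
have := parA u w Ux; rewrite /nabla derive_cst add0r E mul0mx add0r.
by move/eqP; rewrite subr_eq0 => /eqP <-; rewrite addrK.
Qed.

Let B_adj x : U x -> g x *m (B x)^T = B x *m g x.
Proof.
by move=> Ux; rewrite -{1}(symg Ux) -trmx_mul mulmxDl mul1mx linearD/= adjA// symg.
Qed.

Lemma lie_metric x : U x -> lie_derivative xi g x = 2 *: (B x *m g x).
Proof.
move=> Ux; have [Gs Gm] := levi_civita oU sg symg unitg Ux.
rewrite (lie_derivative_parallel (P := B x) _ Gs) => [|||a b].
- by rewrite B_adj// scaler_nat.
- exact: smooth_on_derivable sg Ux.
- by move=> u; rewrite nabla_xi// mulmxDr mulmx1.
- exact: Gm.
Qed.

(** Since A is parallel, so is 2 g(B., .), and [lie_derivative_parallel] applies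
    to it as it does to g. *)
Lemma lie_lie_metric x : U x ->
  lie_derivative xi (lie_derivative xi g) x = 4 *: (B x *m B x *m g x).
Proof.
move=> Ux; have [Gs Gm] := levi_civita oU sg symg unitg Ux.
rewrite (@lie_derivative_near _ _ _ _ (fun y => 2 *: (B y *m g y))); last first.
  by apply: (open_near oU Ux) => y Uy; exact: lie_metric.
have /derivableP dA : derivable A x (xi x) by exact: smooth_on_derivable sA Ux.
have /derivableP dg : derivable g x (xi x) by exact: smooth_on_derivable sg Ux.
have dB := is_deriveD (is_derive_cst (1%:M : 'M[R]_n) x (xi x)) dA.
have dT := is_deriveZ 2 (is_derive_mulmx dB dg).
have [dT1 dTE] := dT.
rewrite (lie_derivative_parallel (P := B x) dT1 Gs) => [||a b].
- rewrite -scalemxAr -scalemxAl -[B x *m g x *m _]mulmxA B_adj// !mulmxA.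
  by rewrite -scalerDl -natrD.
- by move=> u; rewrite nabla_xi// mulmxDr mulmx1.
rewrite dTE !add0r !bilZ bilD !bilMl derive_parallel_endo// bilDl bilNl.
rewrite !mulmxDr !mulmx1 [bil _ (a + _) b]bilDl !Gm !bilDl.
by ring.
Qed.

Lemma soliton_shape_equation lambda mu r x : U x ->
  lie_derivative xi (lie_derivative xi g) x + lambda *: lie_derivative xi g x
    = (mu - r) *: g x ->
  4 *: (B x *m B x) + (2 * lambda) *: B x = (mu - r)%:M.
Proof.
move=> Ux E; apply: (can_inj (mulmxK (unitg Ux))).
rewrite mul_scalar_mx -E lie_lie_metric// lie_metric// mulmxDl -!scalemxAl.
by rewrite scalerA mulrC.
Qed.

End Soliton.

(** * Parallel endomorphisms that are scalar at every point *)

Section ScalarEndo.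
Variables (R : realType) (n : nat) (M : smooth_manifold R n.+1).
Variables (g : riemannian_metric M) (A : endo_field M).

(** If A is scalar at every point, its two Christoffel terms in nabla A cancel, so
    nabla A = 0 says that the entries of A have derivative zero. *)
Lemma parallel_scalar_locally_constant i x r : parallel_endo g A ->
  (forall y, img i y -> A i y = (A i y 0 0)%:M) ->
  ball x r `<=` @img R _ M i ->
  forall y, ball x r y -> A i y 0 0 = A i x 0 0.
Proof.
move=> pA sA sub.
apply: (@derive0_ball_constant R _ (fun z => A i z 0 0)) => y u /sub iy.
have /derivableP dA : derivable (A i) y u.
  exact: smooth_on_derivable (endo_smooth A i) iy.
suff D0 : 'D_u (A i) y = 0.
  by have /is_derive_mxP/(_ 0 0) := dA; rewrite D0 mxE.
apply: bil_inj => v w; rewrite [bil 0 v w]/bil mulmx0 mul0mx mxE /bil.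
rewrite (@derive_parallel_endo _ _ (@img _ _ M i) (g i) (A i)) //.
- rewrite sA// mul_mx_scalar mul_mx_scalar christoffelZr; last first.
    exact: smooth_on_differentiable (metric_smooth g i) iy.
  by rewrite subrr mul0mx mxE.
- exact: endo_smooth.
- by move=> *; exact: pA.
Qed.

(** The transition derivative intertwines the two representatives, and it does
    not vanish because it preserves the metric. *)
Lemma scalar_chart_independent i j x a b : overlap i j x ->
  A i x = a%:M -> A j (transition i j x) = b%:M -> a = b.
Proof.
move=> oij Ai Aj; have [ix jx] := oij.
pose v : 'rV[R]_n.+1 := evec R 0.
have v0 : v != 0.
  apply/eqP => /rowP/(_ 0); rewrite !mxE !eqxx/= => /eqP.
  by rewrite oner_eq0.
have tv0 : 'D_v (transition i j) x != 0.
  apply/eqP => D0; have := metric_pos g ix v0.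
  by rewrite (metric_change g v v oij) D0 bil0l ltxx.
have := endo_change A v oij; rewrite Ai Aj !mul_mx_scalar deriveZr; last first.
  exact: smooth_on_differentiable (transition_smooth i j) oij.
move/eqP; rewrite -subr_eq0 -scalerBl scaler_eq0 (negbTE tv0) orbF subr_eq0.
by move/eqP.
Qed.

Lemma parallel_scalar_constant : connected [set: M] -> parallel_endo g A ->
  (forall i x, img i x -> exists k, A i x = k%:M) ->
  exists k, forall i x, img i x -> A i x = k%:M.
Proof.
move=> cM pA sA.
have sA0 i x : img i x -> A i x = (A i x 0 0)%:M.
  by move=> /sA[k ->]; rewrite mxE eqxx mulr1n.
(* the factor of A as a function on M, read in a chosen chart at each point *)
pose ch p := sval (cid (@dom_cover _ _ M p)).
have chP p : dom (ch p) p by rewrite /ch; case: cid.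
pose h p := A (ch p) (Defs.coord (ch p) p) 0 0.
have hE i p : dom i p -> h p = A i (Defs.coord i p) 0 0.
  move=> ip; have pK := coordK (chP p).
  have ic : img (ch p) (Defs.coord (ch p) p) by exists p.
  have e : transition (ch p) i (Defs.coord (ch p) p) = Defs.coord i p.
    by rewrite /transition pK.
  rewrite /h -e; apply: (@scalar_chart_independent (ch p) i (Defs.coord (ch p) p)).
  - by split=> //; rewrite /= pK.
  - exact: sA0.
  - by rewrite e; apply: sA0; exists p.
have lc p : \forall q \near p, h q = h p.
  pose i := ch p; pose x := Defs.coord i p.
  have ix : img i x by exists p => //; exact: chP.
  have /nbhs_ballP[r /= r0 sub] := open_nbhs_nbhs (conj (@img_open _ _ M i) ix).
  have nq : \forall q \near p, ball x r (Defs.coord i q).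
    exact: (coord_cts (chP p)) (nbhsx_ballx x r r0).
  have nd := open_nbhs_nbhs (conj (dom_open i) (chP p)).
  near=> q; have dq : dom i q by near: q.
  rewrite (hE i q dq) (hE i p (chP p)).
  apply: (parallel_scalar_locally_constant pA (sA0 i) sub).
  by near: q.
have [[p _]|nM] := pselect ([set: M] !=set0); last first.
  by exists 0 => i x [p]; case: nM; exists p.
exists (h p) => i x [q iq <-].
rewrite sA0; last by exists q.
by rewrite -hE// (locally_constant cM lc q p).
Unshelve. all: by end_near. Qed.

End ScalarEndo.

(** * The shape operator of a soliton *)

Section ShapeEquation.
Variables (R : realType) (n m : nat).
Variables (M : smooth_manifold R n) (N : smooth_manifold R m).
Variables (f : M -> N) (g : riemannian_metric M) (gN : riemannian_metric N).
Variables (zeta : vector_field N) (zetaT : vector_field M) (A : endo_field M).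
Variables lambda mu : R.

Lemma local_dom_open i j : continuous f -> open (local_dom f i j).
Proof.
move=> cf; rewrite openE => x [ix jx].
have n1 := open_nbhs_nbhs (conj (@img_open _ _ M i) ix).
have n2 : \forall y \near x, dom j (f (param i y)).
  have := open_nbhs_nbhs (conj (@dom_open _ _ N j) jx).
  by move/(cf (param i x)) => /(param_cts ix).
exact: filterI n1 n2.
Qed.

Lemma metric_unitmx k (K : smooth_manifold R k) (h : riemannian_metric K) i x :
  img i x -> h i x \in unitmx.
Proof. by move=> ix; apply: posdef_unitmx => u; exact: metric_pos. Qed.

(** Around a point of M, a chart of N at its image gives an open set on which
    the immersion is a smooth map between coordinate spaces. *)
Lemma shape_equation :
  concurrent gN zeta ->
  isometric_immersion f g gN ->
  tangential_component f gN zeta zetaT ->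
  hyperbolic_yamabe_soliton g zetaT lambda mu ->
  shape_operator f gN (complement_part f zeta zetaT) A ->
  parallel_endo g A ->
  forall i x, img i x ->
    4 *: ((1%:M + A i x) *m (1%:M + A i x)) + (2 * lambda) *: (1%:M + A i x)
    = (mu - scalar_curvature (g i) x)%:M.
Proof.
move=> cz [[[cf sf] _] iso] tan sol shp pA i x ix.
have [j jx] := @dom_cover _ _ N (f (param i x)).
pose U := local_dom f i j; pose V := @img _ _ N j.
have Ux : U x by [].
have oU : open U by exact: local_dom_open.
have oV : open V by exact: img_open.
have sub : U `<=` @img _ _ M i by move=> y [].
have FV y : U y -> V (local_map f i j y) by move=> [_ jy]; exists (f (param i y)).
have sF : smooth_on U (local_map f i j) by exact: sf.
have sG := metric_smooth gN j.
have sg := smooth_on_subset sub (metric_smooth g i).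
have sxi := smooth_on_subset sub (vf_smooth zetaT i).
have sA := smooth_on_subset sub (endo_smooth A i).
have symG y : V y -> (gN j y)^T = gN j y.
  by move=> Vy; exact: (Defs.metric_sym gN Vy).
have unitG y : V y -> gN j y \in unitmx.
  by move=> Vy; exact: (metric_unitmx gN Vy).
have symg y : U y -> (g i y)^T = g i y.
  by move=> Uy; exact: (Defs.metric_sym g (sub _ Uy)).
have unitg y : U y -> g i y \in unitmx.
  by move=> Uy; exact: (metric_unitmx g (sub _ Uy)).
have isoF y u v : U y -> bil (g i y) u v =
    bil (gN j (local_map f i j y)) ('D_u (local_map f i j) y)
      ('D_v (local_map f i j) y).
  by move=> Uy; exact: iso.
have shpF y u w : U y -> bil (gN j (local_map f i j y))
    (cov (local_map f i j) (gN j) u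
      (fun z => zeta j (local_map f i j z) - 'D_(zetaT i z) (local_map f i j) z) y)
    ('D_w (local_map f i j) y) = - bil (g i y) (u *m A i y) w.
  move=> Uy; have [w' nw' E] := shp i j y u Uy.
  rewrite (isoF _ _ _ Uy) -bilNl -[RHS]addr0 -(nw' w) -bilDl -E.
  by [].
have nor y w : U y -> bil (gN j (local_map f i j y))
   (zeta j (local_map f i j y) - 'D_(zetaT i y) (local_map f i j) y)
   ('D_w (local_map f i j) y) = 0.
  by move=> Uy; exact: tan.
have conc y u : V y -> nabla (gN j) (cst u) (zeta j) y = u by move=> Vy; exact: cz.
have nab y u : U y -> nabla (g i) (cst u) (zetaT i) y = u + u *m A i y.
  exact: (nabla_tangential oU oV FV sF sG symG unitG sg symg unitg isoF
    (vf_smooth zeta j) sxi conc nor shpF).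
have adj y : U y -> (A i y *m g i y)^T = A i y *m g i y.
  exact: (shape_selfadjoint oU oV FV sF sG symG unitG symg
    (vf_smooth zeta j) sxi nor shpF).
have par y u w : U y -> nabla (g i) (cst u) (fun z => w *m A i z) y
    - nabla (g i) (cst u) (cst w) y *m A i y = 0 by move=> Uy; exact: pA (sub _ Uy).
refine (soliton_shape_equation oU sg sA symg unitg nab adj par Ux _).
exact: sol.
Qed.

End ShapeEquation.

Theorem theorem3p1 (R : realType) (n : nat)
  (N : smooth_manifold R n.+1) (gN : riemannian_metric N) (zeta : vector_field N)
  (M : smooth_manifold R n) (g : riemannian_metric M) (f : M -> N)
  (zetaT : vector_field M) (A : endo_field M) (lambda mu : R) :
  connected [set: M] ->
  concurrent gN zeta ->
  isometric_immersion f g gN ->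
  tangential_component f gN zeta zetaT ->
  hyperbolic_yamabe_soliton g zetaT lambda mu ->
  shape_operator f gN (complement_part f zeta zetaT) A ->
  parallel_endo g A ->
  (metallic_endo A <-> constant_scalar_curvature g).
Proof.
move=> cM cz iso tan sol shp pA.
have main i x (ix : img i x) := shape_equation cz iso tan sol shp pA ix.
have eqn i x : img i x -> 4 *: (A i x *m A i x) + (8 + 2 * lambda) *: A i x =
    (mu - scalar_curvature (g i) x - 4 - 2 * lambda)%:M.
  move=> /main; rewrite mulmxDl !mulmxDr !mul1mx !mulmx1 -addrA => E.
  apply/matrixP => a b; move/matrixP/(_ a b): E; rewrite !mxE.
  set p := \sum_k _; case: (a == b) => /=; rewrite ?mulr1n ?mulr0n => E; lra.
split=> [[a [b met]]|[r rE]]; last first.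
  exists (- (8 + 2 * lambda) / 4), ((mu - r - 4 - 2 * lambda) / 4) => i x ix.
  have := eqn i x ix; rewrite rE// => E.
  apply/matrixP => k l; move/matrixP/(_ k l): E; rewrite !mxE.
  set p := \sum_k _; case: (k == l) => /=; rewrite ?mulr1n ?mulr0n => E; lra.
(* in dimension 0 the scalar curvature is an empty sum *)
case: n => [|n] in N gN zeta M g f zetaT A cM cz iso tan sol shp pA main eqn met *.
  by exists 0 => i x _; rewrite /scalar_curvature big_ord0.
(* the metallic equation subtracted from the soliton equation *)
have lin i x : img i x -> (4 * a + 8 + 2 * lambda) *: A i x =
    (mu - scalar_curvature (g i) x - 4 - 2 * lambda - 4 * b)%:M.
  move=> ix; have := eqn i x ix; rewrite met// => E.
  apply/matrixP => k l; move/matrixP/(_ k l): E; rewrite !mxE.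
  case: (k == l) => /=; rewrite ?mulr1n ?mulr0n => E; lra.
have [c0|c0] := eqVneq (4 * a + 8 + 2 * lambda) 0.
  exists (mu - 4 - 2 * lambda - 4 * b) => i x /lin.
  rewrite c0 scale0r => /matrixP/(_ 0 0); rewrite !mxE eqxx mulr1n => E; lra.
have [|k Ak] := parallel_scalar_constant cM pA.
  move=> i x /lin E.
  exists ((4 * a + 8 + 2 * lambda)^-1 *
    (mu - scalar_curvature (g i) x - 4 - 2 * lambda - 4 * b)).
  by rewrite -scale_scalar_mx -E scalerK.
exists (mu - 4 - 2 * lambda - 4 * b - (4 * a + 8 + 2 * lambda) * k) => i x ix.
move/matrixP/(_ 0 0): (lin i x ix); rewrite Ak// !mxE eqxx !mulr1n => E; lra.
Qed.
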